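(* Let $(\theta^k)_{k\in\mathbb N}$ be a Kullback-proximal sequence with relaxation parameters $(\beta_k)_{k\in\mathbb N}$ converging to $\beta^*$, under the standing assumptions listed in the context. Assume that $\beta^*>0$. Let $\theta^*$ be any accumulation point of $(\theta^k)_{k\in\mathbb N}$ and assume that $(\theta^*,\theta^* )\in\operatorname{int} D_I$. Then, if $l_y$ is differentiable on $D_l$, $\theta^*$ is a stationary point of $l_y$, i.e. $\nabla l_y(\theta^* )=0$. Moreover, if $l_y$ is concave, then $\theta^*$ is a global maximizer of $l_y$.
   Context: Setting. $Y$ is a random variable with density $g(y;\theta)$ parametrized by $\theta\in\mathbb R^n$; $y$ is a fixed observation and $l_y(\theta)=\log g(y;\theta)$ is the log-likelihood, with domain $D_l\subset\mathbb R^n$. The complete data $X$ has density $f(x;\theta)$ with respect to a measure $\mu$, $Y=h(X)$, and $k(x|y;\theta)=f(x;\theta)/g(y;\theta)$ is the conditional density of $X$ given $Y=y$. The Kullback distance-like function is $$I_y(\theta,\bar\theta)=\int_{h^{-1}(\{y\})}\log\frac{k(x|y;\bar\theta)}{k(x|y;\theta)}\,k(x|y;\bar\theta)\,d\mu(x).$$ $D_I\subset\mathbb R^n\times\mathbb R^n$ is the domain of $I_y$, and $D_{I,\bar\theta}=\{\theta:(\theta,\bar\theta)\in D_I\}$. For $\beta\ge 0$, $F_\beta(\theta,\bar\theta)=l_y(\theta)-\beta I_y(\theta,\bar\theta)$. A Kullback-proximal sequence with relaxation parameters $(\beta_k)_{k\in\mathbb N}$ is a sequence $(\theta^k)_{k\in\mathbb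 N}$, started at some $\theta^0$, with $\theta^{k+1}\in\operatorname{argmax}_{\theta\in D_l\cap D_{I,\theta^k}} F_{\beta_k}(\theta,\theta^k)$ for all $k$. Standing assumptions. (A1) (i) $l_y$ is differentiable on $D_l$, and $l_y(\theta)\to-\infty$ whenever $\|\theta\|\to+\infty$. (ii) The projection of $D_I$ onto the first coordinate is a subset of $D_l$. (iii) $(\beta_k)$ is a convergent sequence of nonnegative reals with limit $\beta^*$. (A2) (i) There exist a finite dimensional Euclidean space $S$, a differentiable map $t:D_l\to S$ and a functional $\Psi:D_\Psi\subset S\times S\to\mathbb R$ such that $I_y(\theta,\bar\theta)=\Psi(t(\theta),t(\bar\theta))$; the domain $D_I$ is the one determined by $D_l$ and $D_\Psi$, i.e. $D_I=\{(\theta,\bar\theta)\in D_l\times D_l:(t(\theta),t(\bar\theta))\in D_\Psi\}$. (ii) For each $t$ there is $\rho_t>0$ such that for every sequence $(t^k)$ with $(t^k,t)\in D_\Psi$ and $\|t^k-t\|\to\infty$ one has $\liminf_k\Psi(t^k,t)\ge\rho_t$; moreover $\inf_{t\in M}\rho_t>0$ for every bounded $M\subset S$. For all $(t',t)\in D_\Psi$: (iii) $\Psi(t',t)\ge0$; (iv) $\Psi(t',t)=0\Leftrightarrow t=t'$; (v) $\Psi$ is continuous at $(t',t)$. (vi) For all $t$ in the projection of $D_\Psi$ onto its second coordinate, $\Psi(\cdot,t)$ is differentiable at $t$. (A3) The iteration is well defined: at each $k$ there is at least one maximizer of $F_{\beta_k}(\cdot,\theta^k)$. *)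

(* Defs.v *)
From HB Require Import structures.
From mathcomp Require Import all_boot all_order all_algebra.
From mathcomp Require Import all_classical all_reals all_analysis.

Set Implicit Arguments.
Unset Strict Implicit.
Unset Printing Implicit Defensive.

Import Order.TTheory GRing.Theory Num.Theory.
Import numFieldNormedType.Exports.

Local Open Scope classical_set_scope.
Local Open Scope ring_scope.

(* R^n is 'rV[R]_n, whose norm is the sup norm; only topological notions,
   boundedness, divergence to infinity and differentiability are used, and
   these do not depend on the choice of a norm in finite dimension.  Partial
   functions are total functions together with an explicit domain. *)

(** Calculus on a domain *)

(* Differentiability at x of a function that is only meaningful on D: the
   affine approximation is only required along D.  At an interior point of D
   this is [differentiable f x]. *)
Definition differentiable_within (R : realType) (V W : normedModType R)
    (D : set V) (f : V -> W) (x : V) : Prop :=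
  D x /\
  exists2 L : {linear V -> W}, continuous L &
    forall e : R, 0 < e ->
      \forall z \near within D (nbhs x),
        `|f z - f x - L (z - x)| <= e * `|z - x|.

Definition differentiable_on (R : realType) (V W : normedModType R)
    (D : set V) (f : V -> W) : Prop :=
  forall x, D x -> differentiable_within D f x.

Definition gradient (R : realType) (n : nat) (f : 'rV[R]_n -> R)
    (x : 'rV[R]_n) : 'rV[R]_n :=
  \row_(i < n) 'D_(delta_mx 0 i) f x.

Definition stationary_point (R : realType) (n : nat) (f : 'rV[R]_n -> R)
    (x : 'rV[R]_n) : Prop :=
  differentiable f x /\ gradient f x = 0.

Definition concave_on (R : realType) (n : nat) (D : set 'rV[R]_n)
    (f : 'rV[R]_n -> R) : Prop :=
  convex_set D /\ convex_function D (fun x => - f x).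

Definition argmax (R : realType) (T : Type) (A : set T) (F : T -> R) : set T :=
  [set x | A x /\ forall z, A z -> F z <= F x].

(** Densities, log-likelihood and the Kullback distance-like function *)

Definition has_density (R : realType) (d : measure_display)
    (T : measurableType d) (mu : {measure set T -> \bar R})
    (P : set T -> \bar R) (p : T -> R) : Prop :=
  [/\ measurable_fun setT p, (forall x, 0 <= p x) &
      forall A, measurable A -> P A = (\int[mu]_(x in A) (p x)%:E)%E].

Definition loglik (R : realType) (n : nat) (TY : Type)
    (g : TY -> 'rV[R]_n -> R) (y : TY) (theta : 'rV[R]_n) : R :=
  ln (g y theta).

Definition loglik_dom (R : realType) (n : nat) (TY : Type)
    (g : TY -> 'rV[R]_n -> R) (y : TY) : set 'rV[R]_n :=
  [set theta | 0 < g y theta].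

Definition cond_density (R : realType) (n : nat) (TX TY : Type)
    (f : TX -> 'rV[R]_n -> R) (g : TY -> 'rV[R]_n -> R)
    (x : TX) (y : TY) (theta : 'rV[R]_n) : R :=
  f x theta / g y theta.

(* log (q / p) * q for p, q >= 0, with the usual conventions
   0 log (0 / p) = 0 and q log (q / 0) = +oo for q > 0 *)
Definition kl_integrand (R : realType) (p q : R) : \bar R :=
  if q == 0 then 0%E else if p == 0 then +oo%E else (ln (q / p) * q)%:E.

Definition kullback (R : realType) (n : nat) (dX : measure_display)
    (TX : measurableType dX) (TY : Type) (mu : {measure set TX -> \bar R})
    (h : TX -> TY) (f : TX -> 'rV[R]_n -> R) (g : TY -> 'rV[R]_n -> R)
    (y : TY) (theta thetabar : 'rV[R]_n) : R :=
  fine (\int[mu]_(x in h @^-1` [set y])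
    kl_integrand (cond_density f g x y theta) (cond_density f g x y thetabar))%E.

(* the pairs for which both conditional densities are defined and the integral
   defining [kullback] converges *)
Definition kullback_dom (R : realType) (n : nat) (dX : measure_display)
    (TX : measurableType dX) (TY : Type) (mu : {measure set TX -> \bar R})
    (h : TX -> TY) (f : TX -> 'rV[R]_n -> R) (g : TY -> 'rV[R]_n -> R)
    (y : TY) : set ('rV[R]_n * 'rV[R]_n) :=
  [set p | [/\ g y p.1 != 0, g y p.2 != 0 &
    mu.-integrable (h @^-1` [set y]) (fun x =>
      kl_integrand (cond_density f g x y p.1) (cond_density f g x y p.2))]].

(** Kullback-proximal iterations *)

Definition prox_objective (R : realType) (n : nat) (l : 'rV[R]_n -> R)
    (I : 'rV[R]_n -> 'rV[R]_n -> R) (b : R) (theta thetabar : 'rV[R]_n) : R :=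
  l theta - b * I theta thetabar.

Definition prox_argmax (R : realType) (n : nat)
    (Dl : set 'rV[R]_n) (l : 'rV[R]_n -> R)
    (DI : set ('rV[R]_n * 'rV[R]_n)) (I : 'rV[R]_n -> 'rV[R]_n -> R)
    (b : R) (thetabar : 'rV[R]_n) : set 'rV[R]_n :=
  argmax (Dl `&` [set theta | DI (theta, thetabar)])
         (fun theta => prox_objective l I b theta thetabar).

Definition kullback_proximal_sequence (R : realType) (n : nat)
    (Dl : set 'rV[R]_n) (l : 'rV[R]_n -> R)
    (DI : set ('rV[R]_n * 'rV[R]_n)) (I : 'rV[R]_n -> 'rV[R]_n -> R)
    (beta : nat -> R) (theta : nat -> 'rV[R]_n) : Prop :=
  forall k, prox_argmax Dl l DI I (beta k) (theta k) (theta k.+1).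

Record assumption1 (R : realType) (n : nat)
    (Dl : set 'rV[R]_n) (l : 'rV[R]_n -> R) (DI : set ('rV[R]_n * 'rV[R]_n))
    (beta : nat -> R) (beta_star : R) : Prop := Assumption1 {
  a1_differentiable : differentiable_on Dl l ;
  a1_coercive : forall u : nat -> 'rV[R]_n, (forall k, Dl (u k)) ->
    `|u k| @[k --> \oo] --> +oo -> l (u k) @[k --> \oo] --> -oo ;
  a1_proj : fst @` DI `<=` Dl ;
  a1_beta_ge0 : forall k, 0 <= beta k ;
  a1_beta_cvg : beta @ \oo --> beta_star }.

Record assumption2 (R : realType) (n m : nat)
    (Dl : set 'rV[R]_n)
    (DI : set ('rV[R]_n * 'rV[R]_n)) (I : 'rV[R]_n -> 'rV[R]_n -> R)
    (t : 'rV[R]_n -> 'rV[R]_m)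
    (DPsi : set ('rV[R]_m * 'rV[R]_m)) (Psi : 'rV[R]_m * 'rV[R]_m -> R) :
    Prop := Assumption2 {
  a2_differentiable : differentiable_on Dl t ;
  a2_dom : DI = [set p | [/\ Dl p.1, Dl p.2 & DPsi (t p.1, t p.2)]] ;
  a2_factor : forall p, DI p -> I p.1 p.2 = Psi (t p.1, t p.2) ;
  a2_liminf : exists rho : 'rV[R]_m -> R,
    [/\ (forall s, 0 < rho s),
        (forall s (u : nat -> 'rV[R]_m), (forall k, DPsi (u k, s)) ->
           `|u k - s| @[k --> \oo] --> +oo ->
           ((rho s)%:E <= limn_einf (fun k => (Psi (u k, s))%:E))%E) &
        (forall M : set 'rV[R]_m, bounded_set M ->
           (0 < ereal_inf [set (rho s)%:E | s in M])%E)] ;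
  a2_ge0 : forall p, DPsi p -> 0 <= Psi p ;
  a2_eq0 : forall p, DPsi p -> (Psi p = 0 <-> p.2 = p.1) ;
  a2_continuous : forall p, DPsi p ->
    Psi x @[x --> within DPsi (nbhs p)] --> Psi p ;
  a2_diff_diag : forall s, (snd @` DPsi) s ->
    differentiable_within [set s' | DPsi (s', s)] (fun s' => Psi (s', s)) s }.

Definition assumption3 (R : realType) (n : nat)
    (Dl : set 'rV[R]_n) (l : 'rV[R]_n -> R)
    (DI : set ('rV[R]_n * 'rV[R]_n)) (I : 'rV[R]_n -> 'rV[R]_n -> R)
    (beta : nat -> R) (theta : nat -> 'rV[R]_n) : Prop :=
  forall k, prox_argmax Dl l DI I (beta k) (theta k) !=set0.

(* Main.v *)
(* Every point of D_l is at Kullback distance 0 from itself, so l_y increases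
   along the sequence and its values are bounded by l_y(theta_star).  For theta
   near theta_star, comparing theta with theta_(k+1) in the k-th step gives
   l_y(theta) - beta_k I_y(theta, theta_k) <= l_y(theta_star), as I_y >= 0.
   Passing to the limit along the iterates accumulating at theta_star,
   theta_star is a local maximizer of l_y - beta_star I_y(., theta_star); as it
   is also a local minimizer of I_y(., theta_star), both gradients vanish. *)

Require Import Defs.
From HB Require Import structures.
From mathcomp Require Import all_boot all_order all_algebra.
From mathcomp Require Import all_classical all_reals all_analysis.
From mathcomp Require Import lra.

Set Implicit Arguments.
Unset Strict Implicit.
Unset Printing Implicit Defensive.

Import Order.TTheory GRing.Theory Num.Theory.
Import numFieldNormedType.Exports.

Local Open Scope classical_set_scope.
Local Open Scope ring_scope.

(** * Differentiability along a domain and in the usual sense *)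

Lemma differentiable_first_order (R : realType) (V W : normedModType R)
    (f : V -> W) (x : V) : differentiable f x ->
  forall e : R, 0 < e ->
    \forall z \near x, `|f z - f x - 'd f x (z - x)| <= e * `|z - x|.
Proof.
move=> /diff_locally /eqaddoP fx e e0; apply/nbhs0P.
near=> h; rewrite [x + h]addrC addrK -addrA -opprD.
exact: (near (fx _ e0) h).
Unshelve. all: by end_near. Qed.

(** The map [L] gives a little-o expansion on a full neighbourhood, so [diff_unique] identifies it
    with the differential. *)
Lemma differentiable_within_nbhs (R : realType) (V W : normedModType R)
    (D : set V) (f : V -> W) (x : V) :
  differentiable_within D f x -> nbhs x D -> differentiable f x.
Proof.
move=> [_ [L Lc fL]] /nbhs0P xD.
have fE : f \o shift x = cst (f x) + L +o_ 0 id.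
  apply/eqaddoP => e e0.
  have := fL _ e0; rewrite near_withinE => /nbhs0P fLe.
  near=> h.
  have Dh : D (x + h) by near: h.
  have := near fLe h; rewrite [x + h]addrC addrK -addrA -opprD; apply => //.
  by rewrite [h + x]addrC.
have dL := diff_unique Lc fE.
by apply/diff_locallyP; rewrite dL; split.
Unshelve. all: by end_near. Qed.

(* Outside E, g is replaced by its affine approximation, which makes it
   differentiable in the usual sense. *)
Lemma differentiable_within_comp (R : realType) (U V W : normedModType R)
    (E : set V) (f : U -> V) (g : V -> W) (x : U) :
  (\forall z \near x, E (f z)) ->
  differentiable f x -> differentiable_within E g (f x) ->
  differentiable (g \o f) x.
Proof.
move=> fE df [Ex [L Lc gL]].
pose g' y := if y \in E then g y else g (f x) + L (y - f x).
have dg' : differentiable g' (f x).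
  apply: (@differentiable_within_nbhs _ _ _ setT) filterT.
  split=> //; exists L => // e e0; rewrite near_withinE.
  have := gL _ e0; rewrite near_withinE; apply: filterS => y gLy _.
  rewrite /g' (mem_set Ex); case: ifPn => [/set_mem|_]; first exact: gLy.
  by rewrite [_ + L _]addrC addrK subrr normr0 mulr_ge0// ltW.
have dgf := differentiable_comp df dg'.
apply: (@differentiable_within_nbhs _ _ _ (f @^-1` E)) fE.
split=> //; exists ('d (g' \o f) x); first exact: diff_continuous.
move=> e e0; rewrite near_withinE.
apply: filterS (differentiable_first_order dgf e0) => z.
by rewrite /= /g' (mem_set Ex) => + /mem_set Ez; rewrite Ez.
Qed.

(** * First-order conditions for extrema, tested along rays *)

Lemma differentiable_first_order_ray (R : realType) (V : normedModType R)
    (f : V -> R) (x v : V) : differentiable f x ->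
  forall e : R, 0 < e ->
    \forall s \near 0^'+, `|f (x + s *: v) - f x - s * 'D_v f x| <= s * e.
Proof.
move=> fx e e0; rewrite deriveE//.
have [->|v0] := eqVneq v 0.
  near=> s; rewrite scaler0 addr0 subrr linear0 mulr0 subrr normr0.
  by rewrite mulr_ge0// ltW.
have nv : 0 < `|v| by rewrite normr_gt0.
have xv : x + s *: v @[s --> 0^'+] --> x.
  rewrite -[X in _ --> X]addr0 -(scale0r v).
  apply: cvgD; first exact: cvg_cst.
  by apply: cvgZr_tmp; exact: cvg_at_right_filter.
(* The displacement [s *: v] has norm [s * |v|], so the tolerance [e / |v|] turns into the error
   [s * e]. *)
have fxe := differentiable_first_order fx (divr_gt0 e0 nv).
near=> s.
have s0 : 0 < s by [].
have : `|f (x + s *: v) - f x - 'd f x (x + s *: v - x)| <=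
    e / `|v| * `|x + s *: v - x|.
  by near: s; exact: xv fxe.
by rewrite [x + _]addrC addrK linearZ/= normrZ gtr0_norm// mulrCA divfK ?gt_eqF.
Unshelve. all: by end_near. Qed.

Lemma derive_local_max (R : realType) (V : normedModType R) (f : V -> R) (x : V) :
  differentiable f x -> (\forall z \near x, f z <= f x) ->
  forall v, 'D_v f x = 0.
Proof.
move=> fx fmax.
(* The derivative is linear in [v], so the bound at [- v] is the reverse inequality. *)
suff le0 v : 'D_v f x <= 0.
  move=> v; apply/eqP; rewrite eq_le le0 -oppr_le0 deriveE// -linearN.
  by rewrite -deriveE//; exact: le0.
apply/ler_addgt0Pr => e e0; rewrite add0r.
have fray := differentiable_first_order_ray v fx e0.
have xv : x + s *: v @[s --> 0^'+] --> x.
  rewrite -[X in _ --> X]addr0 -(scale0r v).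
  apply: cvgD; first exact: cvg_cst.
  by apply: cvgZr_tmp; exact: cvg_at_right_filter.
near (0:R)^'+ => s.
have s0 : 0 < s by [].
have fle : f (x + s *: v) <= f x by near: s; exact: xv fmax.
have : `|f (x + s *: v) - f x - s * 'D_v f x| <= s * e by near: s.
by rewrite ler_norml => /andP[fge _]; rewrite -(ler_pM2l s0); lra.
Unshelve. all: by end_near. Qed.

(** Apply [derive_local_max] twice: to [- phi], which kills the derivative of the penalty, then to
    [f - b * phi], whose derivative is thus that of [f]. *)
Lemma derive_local_max_penalized (R : realType) (V : normedModType R)
    (f phi : V -> R) (b : R) (x : V) :
  differentiable f x -> differentiable phi x ->
  (\forall z \near x, phi x <= phi z) ->
  (\forall z \near x, f z - b * phi z <= f x - b * phi x) ->
  forall v, 'D_v f x = 0.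
Proof.
move=> df dphi phimin fmax v.
have Df : derivable f x v by exact: diff_derivable.
have Dphi : derivable phi x v by exact: diff_derivable.
have dphi0 : 'D_v phi x = 0.
  apply: oppr_inj; rewrite oppr0 -deriveN//.
  apply: derive_local_max; first exact: differentiableN.
  by apply: filterS phimin => z; rewrite !opprfctE lerN2.
have dbphi : differentiable (b *: phi) x by exact: differentiableZ.
have := derive_local_max (differentiableB df dbphi) fmax v.
rewrite (deriveB Df (derivableZ Dphi)).
by rewrite deriveZ// dphi0 scaler0 subr0.
Qed.

(** At parameter [s], the segment from [x] to [z] has value at least the chord
    [s * f z + (1 - s) * f x] and, to first order, at most [f x + s * e]; dividing by [s] gives
    [f z <= f x + e]. *)
Lemma concave_stationary_max (R : realType) (n : nat) (D : set 'rV[R]_n)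
    (f : 'rV[R]_n -> R) (x : 'rV[R]_n) :
  concave_on D f -> D x -> differentiable f x -> (forall v, 'D_v f x = 0) ->
  argmax D f x.
Proof.
move=> [_ fconc] Dx fx fx0; split=> // z Dz.
apply/ler_addgt0Pr => e e0.
have fray := differentiable_first_order_ray (z - x) fx e0.
near (0:R)^'+ => s.
have s0 : 0 < s by [].
have s1 : s <= 1 by near: s; exact: nbhs_right_le.
have : `|f (x + s *: (z - x)) - f x - s * 'D_(z - x) f x| <= s * e by near: s.
rewrite fx0 mulr0 subr0 => /ler_normlW fle.
have s01 : Itv.spec (@Itv.num_sem R) (Itv.Real `[0%Z, 1%Z]) s.
  by rewrite /= /Itv.num_sem/= num_real/= in_itv/= ltW.
have := fconc (Itv.mk s01) z x (mem_set Dz) (mem_set Dx).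
rewrite convRE /conv/=.
have -> : s *: z + unstable.onem s *: x = x + s *: (z - x).
  by rewrite /unstable.onem scalerBl scalerBr scale1r addrCA.
by rewrite /unstable.onem => fge; rewrite -(ler_pM2l s0); lra.
Unshelve. all: by end_near. Qed.

(** * Cluster points and proximal iterates *)

Lemma cluster_eventually_ex (T : topologicalType) (u : nat -> T) (x : T)
    (P : set nat) (B : set T) :
  cluster (u @ \oo) x -> (\forall k \near \oo, P k) -> nbhs x B ->
  exists k, P k /\ B (u k).
Proof.
move=> ux P_ xB.
(* The image of [P] under [u] belongs to the filter of [u] at infinity, hence meets [B]. *)
have [|_ [[k Pk <-] Bk]] := ux (u @` P) B _ xB; last by exists k.
by apply: filterS P_ => k Pk; exists k.
Qed.

Lemma near_eq_continuous (T U : topologicalType) (f g : T -> U) (x : T) :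
  {near x, f =1 g} -> {for x, continuous f} -> {for x, continuous g}.
Proof.
move=> fg; rewrite /prop_for /continuous_at -(nbhs_singleton fg).
by apply: cvg_trans; apply: near_eq_cvg; apply: filterS fg.
Qed.

(** If [f (u k)] exceeded [f x], continuity would give [f (u j) < f (u k)] at some later [j] with
    [u j] near [x]. *)
Lemma nondecreasing_le_cluster (R : realType) (T : topologicalType)
    (f : T -> R) (u : nat -> T) (x : T) :
  {for x, continuous f} -> nondecreasing_seq (f \o u) ->
  cluster (u @ \oo) x -> forall k, f (u k) <= f x.
Proof.
move=> fx ndf ux k; rewrite leNgt; apply/negP => xk.
have [j [kj]] := cluster_eventually_ex ux (nbhs_infty_ge k)
  (cvgr_lt _ fx _ xk).
by rewrite ltNge => /negP; apply; exact: ndf.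
Qed.

(** The current iterate competes in its own step with zero penalty, and the penalty paid by the next
    one is nonnegative. *)
Lemma prox_sequence_nondecreasing (R : realType) (n : nat)
    (Dl : set 'rV[R]_n) (l : 'rV[R]_n -> R)
    (DI : set ('rV[R]_n * 'rV[R]_n)) (I : 'rV[R]_n -> 'rV[R]_n -> R)
    (beta : nat -> R) (theta : nat -> 'rV[R]_n) :
  (forall k, 0 <= beta k) ->
  (forall p, DI p -> 0 <= I p.1 p.2) ->
  (forall p, DI p -> Dl p.2) ->
  (forall th, Dl th -> DI (th, th) /\ I th th = 0) ->
  kullback_proximal_sequence Dl l DI I beta theta ->
  nondecreasing_seq (l \o theta).
Proof.
move=> beta0 I0 DIDl diag prox; apply/nondecreasing_seqP => k /=.
have [[_ DIk] kmax] := prox k.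
have Dk : Dl (theta k) := DIDl _ DIk.
have [DIkk Ikk] := diag _ Dk.
have := kmax _ (conj Dk DIkk); rewrite /prox_objective Ikk mulr0 subr0.
move=> /le_trans; apply; rewrite gerBl mulr_ge0//; exact: I0 DIk.
Qed.

(** The next iterate enters only through the bound [l (theta k.+1) <= l theta_star], so the limit is
    taken in [beta k] and [theta k] alone, by joint continuity. *)
Lemma prox_sequence_cluster_le (R : realType) (n : nat)
    (Dl : set 'rV[R]_n) (l : 'rV[R]_n -> R)
    (DI : set ('rV[R]_n * 'rV[R]_n)) (I : 'rV[R]_n -> 'rV[R]_n -> R)
    (beta : nat -> R) (beta_star : R) (theta : nat -> 'rV[R]_n)
    (theta_star z : 'rV[R]_n) :
  (forall k, 0 <= beta k) -> beta @ \oo --> beta_star ->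
  (forall p, DI p -> 0 <= I p.1 p.2) ->
  kullback_proximal_sequence Dl l DI I beta theta ->
  cluster (theta @ \oo) theta_star ->
  (forall k, l (theta k) <= l theta_star) ->
  Dl z -> (\forall w \near theta_star, DI (z, w)) ->
  {for theta_star, continuous (I z)} ->
  l z - beta_star * I z theta_star <= l theta_star.
Proof.
move=> beta0 betal I0 prox thetas lmax Dz DIz Iz.
rewrite leNgt; apply/negP => zs.
have : l z - p.1 * I z p.2 @[p --> (beta_star, theta_star)] -->
    l z - beta_star * I z theta_star.
  apply: cvgB; first exact: cvg_cst.
  apply: cvgM; first exact: cvg_fst.
  by apply: (cvg_comp snd (I z) _ Iz); exact: cvg_snd.
move=> /cvgr_gt /(_ _ zs) [[A B] /= [bA sB] AB].
(* [beta k] is eventually in [A], whereas [theta k] only returns to [B] infinitely often; one index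
   serves both. *)
have [k [Ak [DIk Bk]]] := cluster_eventually_ex thetas (betal _ bA)
  (filterI DIz sB).
have := AB (beta k, theta k) (conj Ak Bk); rewrite /= ltNge => /negP; apply.
have [[_ DIk1] kmax] := prox k.
apply: le_trans (kmax z (conj Dz DIk)) _; apply: le_trans (lmax k.+1).
by rewrite /prox_objective gerBl mulr_ge0//; exact: I0 DIk1.
Qed.

(** * The Kullback function on the diagonal *)

Lemma kl_integrandxx (R : realType) (q : R) : kl_integrand q q = 0%E.
Proof.
rewrite /kl_integrand; case: eqVneq => // q0.
by rewrite divff// ln1 mul0r.
Qed.

Lemma kullbackxx (R : realType) (n : nat) (dX : measure_display)
    (TX : measurableType dX) (TY : Type) (mu : {measure set TX -> \bar R})
    (h : TX -> TY) (f : TX -> 'rV[R]_n -> R) (g : TY -> 'rV[R]_n -> R)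
    (y : TY) (th : 'rV[R]_n) : kullback mu h f g y th th = 0.
Proof.
rewrite /kullback; under eq_integral do rewrite kl_integrandxx.
by rewrite integral0.
Qed.

(** The integrand vanishes identically, hence is integrable; this makes each iterate admissible in
    its own step. *)
Lemma kullback_domxx (R : realType) (n : nat) (dX : measure_display)
    (TX : measurableType dX) (TY : Type) (mu : {measure set TX -> \bar R})
    (h : TX -> TY) (f : TX -> 'rV[R]_n -> R) (g : TY -> 'rV[R]_n -> R)
    (y : TY) (th : 'rV[R]_n) :
  measurable (h @^-1` [set y]) -> g y th != 0 ->
  kullback_dom mu h f g y (th, th).
Proof.
move=> mh gth; split => //=.
apply: eq_integrable (integrable0 mu (h @^-1` [set y])) => // x _.
by rewrite /= kl_integrandxx.
Qed.

Theorem corollary3p2p2 (R : realType) (n m : nat)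
    (dO dX dY : measure_display) (Omega : measurableType dO)
    (TX : measurableType dX) (TY : measurableType dY)
    (P : 'rV[R]_n -> probability Omega R)
    (X : {mfun Omega >-> TX}) (Y : {mfun Omega >-> TY}) (h : {mfun TX >-> TY})
    (mu : {measure set TX -> \bar R}) (nu : {measure set TY -> \bar R})
    (f : TX -> 'rV[R]_n -> R) (g : TY -> 'rV[R]_n -> R) (y : TY)
    (t : 'rV[R]_n -> 'rV[R]_m)
    (DPsi : set ('rV[R]_m * 'rV[R]_m)) (Psi : 'rV[R]_m * 'rV[R]_m -> R)
    (beta : nat -> R) (beta_star : R)
    (theta : nat -> 'rV[R]_n) (theta_star : 'rV[R]_n) :
  let l := loglik g y in
  let Dl := loglik_dom g y in
  let I := kullback mu h f g y in
  let DI := kullback_dom mu h f g y in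
  (forall w, Y w = h (X w)) ->
  (forall th, has_density mu (distribution (P th) X) (f ^~ th)) ->
  (forall th, has_density nu (distribution (P th) Y) (g ^~ th)) ->
  measurable (h @^-1` [set y]) ->
  assumption1 Dl l DI beta beta_star ->
  assumption2 Dl DI I t DPsi Psi ->
  assumption3 Dl l DI I beta theta ->
  kullback_proximal_sequence Dl l DI I beta theta ->
  0 < beta_star ->
  cluster (theta @ \oo) theta_star ->
  DI° (theta_star, theta_star) ->
  differentiable_on Dl l ->
  stationary_point l theta_star /\
  (concave_on Dl l -> argmax Dl l theta_star).
Proof.
move=> l Dl I DI _ _ _ mh a1 a2 _ prox _ thetas DIs _.
have DIE := a2_dom a2.
have I0 p : DI p -> 0 <= I p.1 p.2.
  move=> DIp; rewrite (a2_factor a2 DIp); apply: (a2_ge0 a2).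
  by move: DIp; rewrite DIE => -[].
have diag th : Dl th -> DI (th, th) /\ I th th = 0.
  move=> Dth; split; last exact: kullbackxx.
  by apply: kullback_domxx => //; rewrite gt_eqF.
have DIDl p : DI p -> Dl p.2 by rewrite DIE => -[].
(* A box inside [DI]: [A] moves the competitor and [B] moves the previous iterate. *)
have [[A B] /= [sA sB] AB] := DIs.
have sDl : nbhs theta_star Dl.
  apply: filterS sA => z Az.
  have : DI (z, theta_star) by apply: AB; split => //=; exact: nbhs_singleton.
  by rewrite DIE => -[].
have DIss : DI (theta_star, theta_star) := interior_subset DIs.
have Dls : Dl theta_star := DIDl _ DIss.
have dl : differentiable l theta_star.
  exact: differentiable_within_nbhs (a1_differentiable a1 Dls) sDl.
have dt : differentiable t theta_star.
  exact: differentiable_within_nbhs (a2_differentiable a2 Dls) sDl.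
have lmax := nondecreasing_le_cluster (differentiable_continuous dl)
  (prox_sequence_nondecreasing (a1_beta_ge0 a1) I0 DIDl diag prox) thetas.
(* [phi] is [I] with second argument [theta_star], written through [Psi]; the two are known to agree
   on [A], where the factorization applies. *)
pose phi z := Psi (t z, t theta_star).
have DIA z : A z -> DI (z, theta_star).
  by move=> Az; apply: AB; split => //=; exact: nbhs_singleton.
have DPA z : A z -> DPsi (t z, t theta_star).
  by move=> /DIA; rewrite DIE => -[].
have dphi : differentiable phi theta_star.
  apply: (@differentiable_within_comp _ _ _ _
      [set s | DPsi (s, t theta_star)] t (fun s => Psi (s, t theta_star))).
  - exact: filterS sA.
  - exact: dt.
  - apply: (a2_diff_diag a2).
    by exists (t theta_star, t theta_star) => //; exact: DPA (nbhs_singleton sA).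
have phis : phi theta_star = 0.
  exact/(a2_eq0 a2 (DPA _ (nbhs_singleton sA))).
have Icont z : A z -> {for theta_star, continuous (I z)}.
  move=> Az.
  have DIz : \forall w \near theta_star, DI (z, w).
    by apply: filterS sB => w Bw; exact: AB.
  apply: (@near_eq_continuous _ _ (fun w => Psi (t z, t w))).
    by apply: filterS DIz => w /(a2_factor a2)/= ->.
  (* Continuity of [Psi] is relative to [DPsi]; the pairs [(t z, t w)] stay there for [w] near
     [theta_star], because [(z, w)] is in [DI]. *)
  move=> C /(a2_continuous a2 (DPA _ Az)) PC.
  have PCt : \forall w \near theta_star,
      DPsi (t z, t w) -> C (Psi (t z, t w)).
    have tzw := cvg_pair (cvg_cst (t z)) (differentiable_continuous dt).
    exact: (tzw _ _ _ _ _ PC).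
  rewrite -[_ C]/(\forall w \near theta_star, C (Psi (t z, t w))).
  apply: filterS2 DIz PCt => w.
  by rewrite DIE => -[_ _ /=] D1; apply.
have dl0 : forall v, 'D_v l theta_star = 0.
  apply: (derive_local_max_penalized (b := beta_star) dl dphi).
    by apply: filterS sA => z Az; rewrite phis; exact: (a2_ge0 a2 (DPA _ Az)).
  near=> z.
  have Az : A z by near: z.
  (* As [phi] vanishes at [theta_star], local maximality of the penalized likelihood is the limit
     inequality for [z] in [A]. *)
  rewrite phis mulr0 subr0 /phi -(a2_factor a2 (DIA _ Az)).
  apply: (prox_sequence_cluster_le (a1_beta_ge0 a1) (a1_beta_cvg a1) I0 prox
    thetas lmax).
  - by near: z.
  - by apply: filterS sB => w Bw; exact: AB.
  - exact: Icont.
split; last by move=> lconc; exact: concave_stationary_max.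
split => //; apply/rowP => i.
by rewrite !mxE.
Unshelve. all: by end_near. Qed.
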